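(* Let $a,b,w>0$ be real numbers with $w\neq a$. Put $q=1$ if $w<a$ and $q=a/w$ if $w>a$, and let $k=\dfrac{q^2w}{a}$ (so $0<k<1$). Let $\mathcal{A}_{q,egg}=\mathcal{A}_{q,2}+\mathcal{A}_{q,1}$ be the area of the egg-shaped part $\mathcal{F}_{q,egg}$ of the Hügelschäffer curve with parameters $a,b,w$, where $\mathcal{A}_{q,2}$ and $\mathcal{A}_{q,1}$ are the partial areas defined in the context. Then $$\mathcal{A}_{q,egg}=\mathcal{A}_{q,2}+\mathcal{A}_{q,1}=\frac{4}{3}\,a\,b\,q\left(\left(1-\frac{1}{k^2}\right)K(k)+\left(1+\frac{1}{k^2}\right)E(k)\right)$$ and $$\mathcal{A}_{q,2}-\mathcal{A}_{q,1}=\frac{8}{3}\,a\,b\,q\,k=\frac{8}{3}\,w\,b\,q^3=\begin{cases}\dfrac{8}{3}\,w\,b, & w<a,\\[1ex] \dfrac{8}{3w^2}\,b\,a^3, & w>a.\end{cases}$$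
   Context: The Hügelschäffer curve with parameters $a,b,w>0$ is the cubic $2wxy^2+b^2x^2+(a^2+w^2)y^2-a^2b^2=0$. Its egg-shaped part (the part over $x\in[-a,a]$) is denoted $\mathcal{F}_{q,egg}$ and is parametrized by $$x(t)=-q^2w\sin^2t+\cos t\,\sqrt{a^2-q^4w^2\sin^2t},\qquad y(t)=q\,b\sin t,\qquad t\in[0,2\pi];$$ $t\in[0,\pi]$ gives the upper half, from $(a,0)$ to $(-a,0)$. The area of the region bounded by $\mathcal{F}_{q,egg}$ is given by $$\mathcal{A}_{q,egg}=-2\int_0^{\pi}y(t)\,x'(t)\,dt,$$ and it is split as $\mathcal{A}_{q,egg}=\mathcal{A}_{q,2}+\mathcal{A}_{q,1}$ with $$\mathcal{A}_{q,2}=-2\int_0^{\pi/2}y(t)\,x'(t)\,dt,\qquad \mathcal{A}_{q,1}=-2\int_{\pi/2}^{\pi}y(t)\,x'(t)\,dt.$$ Complete elliptic integrals (in terms of the modulus $k$): $K(k)=\int_0^{\pi/2}\frac{d\theta}{\sqrt{1-k^2\sin^2\theta}}$ for $0\le k^2<1$, and $E(k)=\int_0^{\pi/2}\sqrt{1-k^2\sin^2\theta}\,d\theta$ for $0\le k^2\le1$. *)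

(* Defs.v *)
From Stdlib Require Import Reals.
From Coquelicot Require Import Coquelicot.
Open Scope R_scope.

(* The complete elliptic integrals take the modulus [k], not the parameter
   [m = k ^ 2].  They are meaningful for [k ^ 2 < 1] resp. [k ^ 2 <= 1];
   outside that range they carry Coquelicot's default values. *)
Definition ellK (k : R) : R :=
  RInt (fun theta => / sqrt (1 - k ^ 2 * sin theta ^ 2)) 0 (PI / 2).

Definition ellE (k : R) : R :=
  RInt (fun theta => sqrt (1 - k ^ 2 * sin theta ^ 2)) 0 (PI / 2).

(* The case [w = a] is excluded wherever [egg_q] is used. *)
Definition egg_q (a w : R) : R := if Rlt_dec w a then 1 else a / w.

(* Parametrization, over [t] in [[0, 2 PI]], of the egg-shaped part
   (the part over [- a <= x <= a]) of the Huegelschaeffer cubic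
   [2 w x y^2 + b^2 x^2 + (a^2 + w^2) y^2 - a^2 b^2 = 0], for [q = egg_q a w].
   The values [t] in [[0, PI]] give the upper half, run from [(a, 0)] to
   [(- a, 0)]. *)
Definition egg_x (a w q t : R) : R :=
  - q ^ 2 * w * sin t ^ 2 + cos t * sqrt (a ^ 2 - q ^ 4 * w ^ 2 * sin t ^ 2).

Definition egg_y (b q t : R) : R := q * b * sin t.

(* The curve is symmetric in the x-axis, hence the factor 2; the sign is there
   because [x] decreases along the upper half. *)
Definition egg_partial_area (a b w q t0 t1 : R) : R :=
  - 2 * RInt (fun t => egg_y b q t * Derive (egg_x a w q) t) t0 t1.

Definition area_egg (a b w q : R) : R := egg_partial_area a b w q 0 PI.

Definition area_2 (a b w q : R) : R := egg_partial_area a b w q 0 (PI / 2).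

Definition area_1 (a b w q : R) : R := egg_partial_area a b w q (PI / 2) PI.

(* Main.v *)
(** Write [D t] for [sqrt (1 - k^2 (sin t)^2)].  Since [q^2 w = a k], one has
    [x = a (- k sin^2 + cos D)], and the derivative of [sin cos D] can be used
    to reduce [y x'] to
    [a b q ((- 2/3 k sin^3 + 2/3 sin cos D)' - 1/3 ((1 - 1/k^2) / D + (1 + 1/k^2) D))].
    The bracket under the derivative vanishes at [0] and [PI] and equals
    [- 2/3 k] at [PI / 2], while [1 / D] and [D] are symmetric about [PI / 2];
    so the elliptic parts of the two partial areas agree, and the boundary
    terms [4/3 a b q k] and [- 4/3 a b q k] give their difference. *)

Require Import Defs.
From Stdlib Require Import Reals Lra.
From Coquelicot Require Import Coquelicot.
Open Scope R_scope.

Definition ell_delta (k t : R) : R := sqrt (1 - k ^ 2 * sin t ^ 2).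

Lemma ell_radicand_pos (k t : R) : 0 < k < 1 -> 0 < 1 - k ^ 2 * sin t ^ 2.
Proof.
intros hk.
pose proof (sin2_cos2 t) as h; unfold Rsqr in h.
assert (0 <= cos t * cos t) by apply Rle_0_sqr.
assert (0 <= sin t * sin t) by apply Rle_0_sqr.
assert (k * k < 1) by nra.
nra.
Qed.

Lemma ell_delta_pos (k t : R) : 0 < k < 1 -> 0 < ell_delta k t.
Proof. intros hk; apply sqrt_lt_R0, ell_radicand_pos, hk. Qed.

Lemma ell_delta_sqr (k t : R) :
  0 < k < 1 -> ell_delta k t ^ 2 = 1 - k ^ 2 * sin t ^ 2.
Proof. intros hk; apply pow2_sqrt, Rlt_le, ell_radicand_pos, hk. Qed.

Lemma is_derive_ell_delta (k t : R) : 0 < k < 1 ->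
  is_derive (ell_delta k) t (- k ^ 2 * sin t * cos t / ell_delta k t).
Proof.
intros hk.
pose proof (ell_radicand_pos k t hk); pose proof (ell_delta_pos k t hk).
unfold ell_delta in *; auto_derive; simpl in *.
- lra.
- unfold Rminus in *; field; lra.
Qed.

Lemma ex_derive_ell_delta (k t : R) :
  0 < k < 1 -> ex_derive (ell_delta k) t.
Proof. intros hk; eexists; apply is_derive_ell_delta, hk. Qed.

Lemma continuous_ell_delta (k t : R) :
  0 < k < 1 -> continuous (ell_delta k) t.
Proof.
intros hk; apply (ex_derive_continuous (ell_delta k)).
apply ex_derive_ell_delta, hk.
Qed.

Lemma continuous_inv_ell_delta (k t : R) :
  0 < k < 1 -> continuous (fun t => / ell_delta k t) t.
Proof.
intros hk; apply (continuous_comp (ell_delta k) Rinv).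
- apply continuous_ell_delta, hk.
- apply continuous_Rinv, Rgt_not_eq, ell_delta_pos, hk.
Qed.

Lemma is_RInt_ellE (k : R) :
  0 < k < 1 -> is_RInt (ell_delta k) 0 (PI / 2) (ellE k).
Proof.
intros hk; apply (RInt_correct (ell_delta k)), (ex_RInt_continuous (ell_delta k)).
intros t _; apply continuous_ell_delta, hk.
Qed.

Lemma is_RInt_ellK (k : R) :
  0 < k < 1 -> is_RInt (fun t => / ell_delta k t) 0 (PI / 2) (ellK k).
Proof.
intros hk; apply (RInt_correct (fun t => / ell_delta k t)).
apply (ex_RInt_continuous (fun t => / ell_delta k t)).
intros t _; apply continuous_inv_ell_delta, hk.
Qed.

(** The substitution [t -> PI - t] carries one quarter onto the other with reversed orientation; its
    factor -1 cancels the sign from swapping the limits. *)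
Lemma is_RInt_reflect_PI (f : R -> R) (l : R) :
  (forall t, f (PI - t) = f t) ->
  is_RInt f 0 (PI / 2) l -> is_RInt f (PI / 2) PI l.
Proof.
intros hf hl.
(* One sign goes with the slope -1 that [is_RInt_comp_lin] puts into the integrand, the other with
   [is_RInt_swap]. *)
rewrite <- (Ropp_involutive l).
apply (is_RInt_ext (fun t => - scal (-1) (f (-1 * t + PI)))).
- intros t _; rewrite <- (hf t).
  replace (-1 * t + PI) with (PI - t) by ring.
  unfold scal; simpl; unfold mult; simpl; ring.
- apply (is_RInt_opp (fun t => scal (-1) (f (-1 * t + PI)))).
  apply (is_RInt_comp_lin f).
  replace (-1 * (PI / 2) + PI) with (PI / 2) by lra.
  replace (-1 * PI + PI) with 0 by ring.
  apply (is_RInt_swap f), hl.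
Qed.

Lemma ell_delta_reflect_PI (k t : R) : ell_delta k (PI - t) = ell_delta k t.
Proof. unfold ell_delta; now rewrite sin_PI_x. Qed.

(** The first term integrates the part of [y x'] free of the square root. The coefficient 2/3 of the
    second is the one that cancels [sin^4 / D], leaving only multiples of [1 / D] and [D]. *)
Definition egg_boundary (k t : R) : R :=
  - (2 / 3) * k * sin t ^ 3 + 2 / 3 * (sin t * cos t * ell_delta k t).

Definition egg_boundary' (k t : R) : R :=
  - 2 * k * sin t ^ 2 * cos t
  + 2 / 3 * ((cos t ^ 2 - sin t ^ 2) * ell_delta k t
             - k ^ 2 * sin t ^ 2 * cos t ^ 2 / ell_delta k t).

Lemma is_derive_egg_boundary (k t : R) : 0 < k < 1 ->
  is_derive (egg_boundary k) t (egg_boundary' k t).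
Proof.
intros hk.
pose proof (ell_delta_pos k t hk).
pose proof (is_derive_ell_delta k t hk) as hd.
unfold egg_boundary, egg_boundary'; auto_derive.
- apply ex_derive_ell_delta, hk.
- replace (Derive (fun x => ell_delta k x) t)
    with (- k ^ 2 * sin t * cos t / ell_delta k t)
    by (symmetry; apply is_derive_unique, hd).
  field; lra.
Qed.

Lemma continuous_egg_boundary' (k t : R) : 0 < k < 1 ->
  continuous (egg_boundary' k) t.
Proof.
intros hk.
pose proof (ell_delta_pos k t hk).
apply (ex_derive_continuous (egg_boundary' k)).
unfold egg_boundary'; auto_derive.
repeat split; try (apply ex_derive_ell_delta, hk); lra.
Qed.

Lemma is_derive_egg_x (a w q k t : R) : 0 < a -> 0 < k < 1 -> q ^ 2 * w = a * k ->
  is_derive (egg_x a w q) t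
    (a * (- 2 * k * sin t * cos t - sin t * ell_delta k t
          - k ^ 2 * sin t * cos t ^ 2 / ell_delta k t)).
Proof.
intros ha hk hq.
apply (is_derive_ext
  (fun t => a * (- k * sin t ^ 2 + cos t * ell_delta k t))).
- intros u; unfold egg_x, ell_delta.
  (* The radicand becomes [a^2 D^2], and [a > 0] lets [a] leave the root. *)
  replace (a ^ 2 - q ^ 4 * w ^ 2 * sin u ^ 2)
    with (a ^ 2 * (1 - k ^ 2 * sin u ^ 2))
    by (replace (q ^ 4 * w ^ 2) with ((q ^ 2 * w) ^ 2) by ring;
        rewrite hq; ring).
  rewrite sqrt_mult_alt, sqrt_pow2 by (try apply pow2_ge_0; lra).
  replace (- q ^ 2 * w) with (- (a * k)) by (rewrite <- hq; ring).
  apply Rminus_diag_uniq; ring.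
- pose proof (ell_delta_pos k t hk).
  pose proof (is_derive_ell_delta k t hk) as hd.
  auto_derive.
  + apply ex_derive_ell_delta, hk.
  + replace (Derive (fun x => ell_delta k x) t)
      with (- k ^ 2 * sin t * cos t / ell_delta k t)
      by (symmetry; apply is_derive_unique, hd).
    field; lra.
Qed.

Lemma egg_integrand (a b w q k t : R) :
  0 < a -> 0 < k < 1 -> q ^ 2 * w = a * k ->
  egg_y b q t * Derive (egg_x a w q) t =
  a * b * q *
    (egg_boundary' k t
     - 1 / 3 * ((1 - 1 / k ^ 2) * / ell_delta k t
                + (1 + 1 / k ^ 2) * ell_delta k t)).
Proof.
intros ha hk hq.
rewrite (is_derive_unique _ _ _ (is_derive_egg_x a w q k t ha hk hq)).
unfold egg_y, egg_boundary'.
pose proof (ell_delta_pos k t hk) as hD.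
assert (hc : cos t ^ 2 = 1 - sin t ^ 2)
  by (pose proof (sin2_cos2 t) as h; unfold Rsqr in h; lra).
(* Solving for [sin^2] instead of [D^2] makes [D] a free variable; this is where the [1 / k^2] of
   the final formula arises. *)
assert (hs : sin t ^ 2 = (1 - ell_delta k t ^ 2) / k ^ 2)
  by (rewrite ell_delta_sqr by exact hk; field; lra).
apply Rminus_diag_uniq.
(* In the difference, the only term odd in [cos t], namely [- 2 k sin^2 cos], cancels. The rest
   contains [sin] and [cos] only through their squares, so [hc] and [hs] turn it into a rational
   identity in [k] and [D]. *)
transitivity (a * b * q *
  (- (1 / 3) * sin t ^ 2 * ell_delta k t - 2 / 3 * cos t ^ 2 * ell_delta k t
   - 1 / 3 * k ^ 2 * sin t ^ 2 * cos t ^ 2 / ell_delta k t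
   + 1 / 3 * ((1 - 1 / k ^ 2) * / ell_delta k t
              + (1 + 1 / k ^ 2) * ell_delta k t))).
- field; lra.
- rewrite hc, hs; field; lra.
Qed.

(** Limits and elliptic integrals are left general so that both quarters are instances, differing
    only in their boundary values. *)
Lemma egg_partial_area_ell (a b w q k t0 t1 lK lE : R) :
  0 < a -> 0 < k < 1 -> q ^ 2 * w = a * k ->
  is_RInt (fun t => / ell_delta k t) t0 t1 lK ->
  is_RInt (ell_delta k) t0 t1 lE ->
  is_RInt (fun t => egg_y b q t * Derive (egg_x a w q) t) t0 t1
    (a * b * q * (egg_boundary k t1 - egg_boundary k t0
      - 1 / 3 * ((1 - 1 / k ^ 2) * lK + (1 + 1 / k ^ 2) * lE))).
Proof.
intros ha hk hq hK hE.
eapply is_RInt_ext.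
- intros t _; symmetry; apply (egg_integrand a b w q k t ha hk hq).
- apply (is_RInt_scal (V := R_NormedModule)).
  apply (is_RInt_minus (V := R_NormedModule)).
  + apply (is_RInt_derive (V := R_CompleteNormedModule) (egg_boundary k)).
    * intros t _; apply is_derive_egg_boundary, hk.
    * intros t _; apply continuous_egg_boundary', hk.
  + apply (is_RInt_scal (V := R_NormedModule)).
    apply (is_RInt_plus (V := R_NormedModule)).
    * apply (is_RInt_scal (V := R_NormedModule)), hK.
    * apply (is_RInt_scal (V := R_NormedModule)), hE.
Qed.

(** The quotient is [w / a] when [w < a] and [a / w] otherwise: the smaller length over the larger,
    strictly below 1 because [w <> a]. *)
Lemma egg_modulus (a w : R) : 0 < a -> 0 < w -> w <> a ->
  0 < egg_q a w ^ 2 * w / a < 1.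
Proof.
intros ha hw hwa; unfold egg_q; destruct (Rlt_dec w a) as [h | h].
- replace (1 ^ 2 * w / a) with (w / a) by (field; lra).
  split; [now apply Rdiv_lt_0_compat | now apply Rlt_div_l; lra].
- replace ((a / w) ^ 2 * w / a) with (a / w) by (field; lra).
  split; [now apply Rdiv_lt_0_compat | apply Rlt_div_l; lra].
Qed.

Theorem theorem2p1 (a b w : R) (ha : 0 < a) (hb : 0 < b) (hw : 0 < w)
    (hwa : w <> a) :
  let q := egg_q a w in
  let k := q ^ 2 * w / a in
  0 < k < 1 /\
  area_egg a b w q = area_2 a b w q + area_1 a b w q /\
  area_egg a b w q =
    4 / 3 * a * b * q *
      ((1 - 1 / k ^ 2) * ellK k + (1 + 1 / k ^ 2) * ellE k) /\
  area_2 a b w q - area_1 a b w q = 8 / 3 * a * b * q * k /\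
  8 / 3 * a * b * q * k = 8 / 3 * w * b * q ^ 3 /\
  (w < a -> 8 / 3 * w * b * q ^ 3 = 8 / 3 * w * b) /\
  (w > a -> 8 / 3 * w * b * q ^ 3 = 8 / (3 * w ^ 2) * b * a ^ 3).
Proof.
intros q k.
assert (hk : 0 < k < 1) by now apply egg_modulus.
assert (hq : q ^ 2 * w = a * k) by (unfold k; field; lra).
pose proof (is_RInt_ellK k hk) as hK.
pose proof (is_RInt_ellE k hk) as hE.
assert (hK' : is_RInt (fun t => / ell_delta k t) (PI / 2) PI (ellK k))
  by (apply is_RInt_reflect_PI;
      [intros t; now rewrite ell_delta_reflect_PI | exact hK]).
assert (hE' : is_RInt (ell_delta k) (PI / 2) PI (ellE k))
  by (apply is_RInt_reflect_PI; [apply ell_delta_reflect_PI | exact hE]).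
pose proof (egg_partial_area_ell a b w q k _ _ _ _ ha hk hq hK hE) as h2.
pose proof (egg_partial_area_ell a b w q k _ _ _ _ ha hk hq hK' hE') as h1.
(* Additivity over the two quarters gives the integral over [[0, PI]] together with its
   existence. *)
pose proof (is_RInt_Chasles (V := R_NormedModule) _ _ _ _ _ _ h2 h1) as h.
change (@plus R_NormedModule) with Rplus in h.
assert (b0 : egg_boundary k 0 = 0)
  by (unfold egg_boundary; rewrite sin_0; ring).
assert (b1 : egg_boundary k (PI / 2) = - (2 / 3) * k)
  by (unfold egg_boundary; rewrite sin_PI2, cos_PI2; ring).
assert (b2 : egg_boundary k PI = 0)
  by (unfold egg_boundary; rewrite sin_PI; ring).
unfold area_egg, area_2, area_1, egg_partial_area.
rewrite (is_RInt_unique _ _ _ _ h), (is_RInt_unique _ _ _ _ h1),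
  (is_RInt_unique _ _ _ _ h2), b0, b1, b2.
repeat split; try apply hk.
- ring.
- field; lra.
- field; lra.
(* Splitting [q^3] as [q * q^2] exposes [q^2 w], which is [a k]. *)
- replace (8 / 3 * w * b * q ^ 3) with (8 / 3 * b * q * (q ^ 2 * w)) by ring.
  rewrite hq; ring.
- intros h'; unfold q, egg_q; destruct (Rlt_dec w a); [ring | lra].
- intros h'; unfold q, egg_q; destruct (Rlt_dec w a); [lra | field; lra].
Qed.
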